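(* Up to isomorphism, the alternating group $A_5$ is the unique finite group $G$ such that $o(G)=\frac{211}{60}$. That is, for every finite group $G$, one has $o(G)=\frac{211}{60}$ if and only if $G\cong A_5$.
   Context: For a finite group $G$, let $o(x)$ denote the order of an element $x\in G$. Let $\psi(G)=\sum_{x\in G}o(x)$ be the sum of element orders of $G$, and let $o(G)=\frac{\psi(G)}{|G|}$ be the average order of $G$ (a rational number). $A_5$ is the alternating group on $5$ letters. *)

(* Defs.v *)
From HB Require Import structures.
From mathcomp Require Import all_boot all_order all_algebra all_fingroup all_solvable.

Set Implicit Arguments.
Unset Strict Implicit.
Unset Printing Implicit Defensive.

Definition sum_orders (gT : finGroupType) (G : {group gT}) : nat :=
  (\sum_(x in G) #[x]%g)%N.

Definition average_order (gT : finGroupType) (G : {group gT}) : rat :=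
  ((sum_orders G)%:R / #|G|%:R)%R.

(* Main.v *)
Require Import Defs.
From HB Require Import structures.
From mathcomp Require Import all_boot all_order all_algebra all_fingroup all_solvable.
From mathcomp Require Import zify.

(** Write psi for the sum of the element orders. Pairing x with x^-1 shows that
    psi(G) is odd, so o(G) = 211/60 forces |G| = 60k with k odd, and a Sylow
    2-subgroup S has order 4. Orbits of N(S) on S - {1} have odd length, hence
    N(S) either centralises S or permutes S - {1} transitively.
    In the first case G = K ><| S with |K| = 15k odd, by Burnside's transfer
    theorem, and summing the orders over the cosets Ks gives psi(G) > 211k: a
    coset of an involution s contains few involutions unless s inverts K, in
    which case K is abelian and psi(K) is large.
    In the second case S is a four-group, all involutions are conjugate, and the
    centraliser of an involution t is U ><| S with U of odd order c. The elements
    with 2-part t form the coset tU, so |G|/4 elements have even order, and the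
    value of psi(G) forces c = 1 or c = 3 together with a large number of
    solutions of x^3 = 1. If x^3 = (tx)^3 = 1 then t commutes with t^(x^-1) <> t,
    which bounds that number; the bounds leave only |G| = 60 and c = 1. Then
    N(S) has index 5 and G embeds in the symmetric group on 5 letters. *)

Set Implicit Arguments.
Unset Strict Implicit.
Unset Printing Implicit Defensive.
Import GroupScope.

(** * Fusion in abelian Sylow subgroups and Burnside's transfer theorem *)

(** Both [S] and [S :^ y] are Sylow in the centraliser of [x ^ y], being abelian. Some [c] in that
    centraliser carries [S :^ y] back to [S], and [y * c] acts on [x] as [y] does. *)
Lemma abelian_Sylow_fusion (gT : finGroupType) (G S : {group gT}) p x y :
    p.-Sylow(G) S -> abelian S -> x \in S -> y \in G -> x ^ y \in S ->
  exists2 z, z \in 'N_G(S) & x ^ y = x ^ z.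
Proof.
move=> sylS cSS Sx Gy Sxy.
have sylC (Q : {group gT}) :
    p.-Sylow(G) Q -> Q \subset 'C[x ^ y] -> p.-Sylow('C_G[x ^ y]) Q.
  move=> sylQ cQ; apply: pHall_subl (sylQ); last exact: subsetIl.
  by rewrite subsetI (pHall_sub sylQ).
have sylS1 : p.-Sylow('C_G[x ^ y]) S.
  by apply: sylC => //; rewrite sub_cent1 (subsetP cSS).
have sylS2 : p.-Sylow('C_G[x ^ y]) (S :^ y)%G.
  apply: sylC; first by rewrite pHallJ.
  by rewrite sub_cent1 /= centJ memJ_conjg (subsetP cSS).
have [c /setIP[Gc /cent1P cxy] defS] := Sylow_trans sylS2 sylS1.
exists (y * c).
  by rewrite inE groupM //=; apply/normP; rewrite conjsgM -defS.
rewrite conjgM; apply/esym/conjg_fixP/commgP; exact: commute_sym.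
Qed.

(** On [S] the transfer is the power map of exponent [#|G : S|], which is injective because the
    index is coprime to [#|S|]. Its kernel thus meets [S] trivially and has index at most [#|S|], so
    it is a complement. *)
Lemma Burnside_normal_complement (gT : finGroupType) (G S : {group gT}) p :
  p.-Sylow(G) S -> 'N_G(S) \subset 'C(S) -> 'O_p^'(G) ><| S = G.
Proof.
move=> sylS cNS; have sSG := pHall_sub sylS.
have cSS : abelian S.
  by apply: subset_trans cNS; rewrite subsetI sSG normG.
have abS : abelian (idm S @* S) by rewrite im_idm.
have imS s : s \in S -> s \in (idm_morphism S @* S)%G by rewrite /= im_idm.
pose T := [morphism of transfer G (alpha := idm_morphism S) abS].
(* The conjugates in the cycle expansion of the transfer are already conjugate
   under N(S), which centralises S. *)
have TS : {in S, forall s, T s = FiniteModule.fmod abS (s ^+ #|G : S|)}.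
  move=> s Ss; have Gs := subsetP sSG s Ss.
  have partS := rcosets_cycle_partition sSG Gs.
  have trX := transversalP partS; set X := transversal _ _ in trX.
  rewrite /= (transfer_cycle_expansion sSG abS Gs trX).
  rewrite -(sum_index_rcosets_cycle sSG Gs trX) (FiniteModule.fmodX abS _ (imS s Ss)).
  rewrite -GRing.sumrMnr; apply: eq_bigr => x Xx.
  have Gx : x \in G by apply: subsetP Xx; apply: transversal_sub trX.
  rewrite -(FiniteModule.fmodX abS _ (imS s Ss)) /=; set n := #|_ : _|.
  rewrite /restrm /=; congr (FiniteModule.fmod _ _).
  have Sn : s ^+ n \in S by rewrite groupX.
  have Snx : (s ^+ n) ^ x^-1 \in S.
    by rewrite conjgE invgK mulgA -mem_rcoset; apply: mulg_exp_card_rcosets.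
  have [z /(subsetP cNS) cz ->] :=
    abelian_Sylow_fusion sylS cSS Sn (groupVr Gx) Snx.
  by apply/conjg_fixP/commgP/commute_sym/(centP cz).
pose K := 'ker T.
have coS : coprime #|S| #|G : S|.
  have /and3P[_ pS p'S] := sylS; exact: pnat_coprime pS p'S.
have tiKS : K :&: S = 1.
  apply/trivgP/subsetP=> s /setIP[/mker + Ss]; rewrite TS //.
  rewrite -[1](FiniteModule.fmod1 abS) => /(congr1 val).
  rewrite !FiniteModule.fmodK ?imS ?groupX // => s1.
  rewrite inE -order_eq1 -dvdn1 -(eqP coS) dvdn_gcd order_dvdG //.
  by rewrite order_dvdn s1 eqxx.
have nKG : K <| G := ker_normal _.
have sKG := normal_sub nKG.
have cardK : (#|G : K| <= #|S|)%N.
  rewrite -card_quotient ?normal_norm // (card_isog (first_isog T)).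
  apply: leq_trans (max_card _) _.
  by rewrite card_sub; apply: subset_leq_card; apply/subsetP=> x; rewrite !inE /= im_idm.
have defG : K * S = G.
  apply/eqP; rewrite eqEcard mul_subG //= TI_cardMg //.
  by rewrite -(Lagrange sKG) leq_mul.
have nSK : S \subset 'N(K) := subset_trans sSG (normal_norm nKG).
have sdG : K ><| S = G by rewrite sdprodE.
have /and3P[_ pS p'S] := sylS.
suff -> : 'O_p^'(G) = K by [].
apply: normal_Hall_pcore => //; apply/and3P; split=> //.
  by move: p'S; rewrite -divgS // -(sdprod_card sdG) mulnK.
by rewrite -(index_sdprod sdG) pnatNK.
Qed.

(** * Parity and lower bounds for sums of element orders *)

(** Off the fixed points of [h] the terms pair up with equal values and cancel modulo 2. *)
Lemma odd_sum_involution (T : finType) (P : pred T) (h : T -> T) (F : T -> nat) :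
    involutive h -> (forall x, P x -> P (h x)) -> (forall x, F (h x) = F x) ->
  odd (\sum_(x | P x) F x) = odd (\sum_(x | P x && (h x == x)) F x).
Proof.
move=> hK Ph Fh.
have Ph' x : P (h x) = P x by apply/idP/idP=> /Ph //; rewrite hK.
(* [lt_h] selects one element of each 2-cycle of h. *)
pose lt_h x := (enum_rank x < enum_rank (h x))%N.
have eqF : (\sum_(x | P x && (h x != x) && ~~ lt_h x) F x =
            \sum_(x | P x && (h x != x) && lt_h x) F x)%N.
  rewrite (reindex_inj (inv_inj hK)); apply: eq_big => x; last by rewrite Fh.
  rewrite /lt_h hK Ph' [x == _]eq_sym -leqNgt [in RHS]ltn_neqAle.
  rewrite (inj_eq val_inj) (inj_eq enum_rank_inj) [x == _]eq_sym.
  by case: (h x == x); rewrite ?andbF.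
rewrite [in LHS](bigID (fun x => h x == x)) /=.
by rewrite [X in (_ + X)%N](bigID lt_h) /= eqF !oddD addbb addbF.
Qed.

(** Apart from 1, the fixed points of inversion are the involutions, whose order is even. *)
Lemma odd_sum_orders (gT : finGroupType) (G : {group gT}) : odd (sum_orders G).
Proof.
rewrite /sum_orders (odd_sum_involution (@invgK gT)) => [|x|x].
- rewrite (bigD1 1) /=; last by rewrite group1 invg1 eqxx.
  rewrite order1 oddD big_seq_cond; set X := (\sum_(i <- _ | _) _)%N.
  suff -> : odd X = false by [].
  apply/negbTE; rewrite -dvdn2; apply: dvdn_sum => x.
  case/and3P=> _ /andP[_ /eqP xV] nt_x; rewrite (_ : #[x] = 2) //.
  by apply: nt_prime_order => //; rewrite expgS expg1 -{1}xV mulVg.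
- by rewrite groupV.
by rewrite orderV.
Qed.

Lemma sum_orders_odd_group (gT : finGroupType) (K : {group gT}) :
  odd #|K| -> (3 * #|K| <= sum_orders K + 2)%N.
Proof.
move=> oddK; rewrite /sum_orders (big_setD1 1) //= order1.
suff: (3 * #|K :\ 1%g| <= \sum_(x in K :\ 1%g) #[x])%N.
  by rewrite (cardsD1 1 K) group1; set c := #|_|; set s := bigop _ _ _; lia.
rewrite mulnC -sum_nat_const; apply: leq_sum => x /setD1P[nt_x Kx].
have: odd #[x] by apply: dvdn_odd (order_dvdG Kx) oddK.
by move: nt_x; rewrite -order_eq1; case: #[x] => [|[|[]]].
Qed.

(** Elements outside the Sylow 3-subgroup [P] have order at least 5, and [P] has index at least 5,
    so psi(K) >= 5|K| - 4|P| >= (21/5)|K|. *)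
Lemma sum_orders_abelian (gT : finGroupType) (K : {group gT}) :
  odd #|K| -> (5 %| #|K|)%N -> abelian K -> (21 * #|K| <= 5 * sum_orders K)%N.
Proof.
move=> oddK d5 abK; have [P sylP] := Sylow_exists 3 K.
have [sPK p3P p3'] := and3P sylP.
have nPK : P <| K by rewrite -(sub_abelian_normal P abK).
have le5 : (5 * #|P| <= #|K|)%N.
  rewrite -(Lagrange sPK) mulnC leq_mul // dvdn_leq //.
  rewrite -(@Gauss_dvdr _ #|P|) ?Lagrange //.
  by rewrite coprime_sym (pnat_coprime p3P).
have le1 : (5 * (#|K| - #|P|) + #|P| <= sum_orders K)%N.
  rewrite /sum_orders (big_setID P) /= (setIidPr sPK) addnC leq_add //.
    by rewrite -sum1_card leq_sum.
  rewrite -cardsDS // mulnC -sum_nat_const leq_sum // => x /setDP[Kx].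
  have: odd #[x] by apply: dvdn_odd (order_dvdG Kx) oddK.
  rewrite (mem_normal_Hall sylP) // /p_elt.
  by case: #[x] (order_gt0 x) => [|[|[|[|[]]]]].
lia.
Qed.

(** * Sylow 2-subgroups of order four *)

Lemma Sylow2_order4_fusion (gT : finGroupType) (G S : {group gT}) :
    2.-Sylow(G) S -> #|S| = 4 ->
  'N_G(S) \subset 'C(S) \/ {in S^#, forall s, s ^: 'N_G(S) = S^#}.
Proof.
move=> sylS oS; have sSG := pHall_sub sylS.
have cSS : abelian S by apply: (@card_p2group_abelian _ 2).
case: (boolP ('N_G(S) \subset 'C(S))) => [|/subsetPn[n Nn]]; first by left.
rewrite -sub_cent1 => /subsetPn[s Ss ns_s]; right.
have sSN : S \subset 'N_G(S) by rewrite subsetI sSG normG.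
(* Since [S] centralises [s], the orbit length divides [#|G : S|]. *)
have oddN : odd #|s ^: 'N_G(S)|.
  rewrite -index_cent1; apply: (@dvdn_odd _ #|G : S|); last first.
    by have /and3P[_ _] := sylS; rewrite p'natE // dvdn2 negbK.
  apply: (@dvdn_trans #|'N_G(S) : S|); last by rewrite indexSg ?subsetIl.
  by rewrite indexgS // subsetI sSN sub_cent1 (subsetP cSS).
have nt_s : s != 1 by apply: contraNneq ns_s => ->; apply: group1.
have sNS : s ^: 'N_G(S) \subset S^#.
  apply/subsetP=> _ /imsetP[m /setIP[_ nSm] ->].
  by rewrite !inE conjg_eq1 nt_s memJ_norm.
have eqS : s ^: 'N_G(S) = S^#.
  apply/eqP; rewrite eqEcard sNS; have := cardsD1 1 S; rewrite oS group1.
  case: #|S^#| => [|[|[|[]]]] // _.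
  move: oddN; rewrite (cardsD1 s) class_refl (cardsD1 (s ^ n)) !inE memJ_class //.
  suff -> : s ^ n != s by case: #|_|.
  by apply: contra ns_s => /eqP/conjg_fixP/commgP sn; apply/cent1P/commute_sym.
by move=> x; rewrite -{1}eqS => /class_eqP ->.
Qed.

(** Inside its own centraliser [t] is conjugate only to itself, so the first alternative of
    [Sylow2_order4_fusion] holds there and Burnside's theorem applies. *)
Lemma Sylow2_order4_cent1 (gT : finGroupType) (G S : {group gT}) t :
    2.-Sylow(G) S -> #|S| = 4 -> t \in S^# ->
  'O_2^'('C_G[t]) ><| S = 'C_G[t].
Proof.
move=> sylS oS /setD1P[nt_t St]; have sSG := pHall_sub sylS.
have cSS : abelian S by apply: (@card_p2group_abelian _ 2).
have sylC : 2.-Sylow('C_G[t]) S.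
  apply: pHall_subl (sylS); last exact: subsetIl.
  by rewrite subsetI sSG sub_cent1 (subsetP cSS).
have [cNS | fus] := Sylow2_order4_fusion sylC oS.
  exact: Burnside_normal_complement.
have St1 : t \in S^# by rewrite !inE nt_t.
have := cardsD1 1 S; rewrite oS group1 -(fus t St1).
suff -> : t ^: 'N_('C_G[t])(S) = [set t] by rewrite cards1.
apply/eqP; rewrite eqEsubset sub1set class_refl andbT.
apply/subsetP=> _ /imsetP[x /setIP[/setIP[_ cx] _] ->].
by rewrite inE; apply/eqP/conjg_fixP/commgP/commute_sym/cent1P.
Qed.

(** [U] consists of the odd-order elements of the centraliser of [z], so the elements with 2-part
    [z] form the coset zU, and [z * u] has order 2o(u). *)
Lemma sum_orders_constt2 (gT : finGroupType) (G U : {group gT}) z :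
    z \in G -> #[z] = 2 -> 2^'.-Hall('C_G[z]) U -> U <| 'C_G[z] ->
  [/\ (\sum_(x in G | x.`_2 == z) #[x] = 2 * sum_orders U)%N
    & #|[set x in G | x.`_2 == z]| = #|U| ].
Proof.
move=> Gz oz hallU nU.
have sUC := pHall_sub hallU; have oddU : odd #|U|.
  by have := pHall_pgroup hallU; rewrite /pgroup p'natE // dvdn2 negbK.
have Uspec u : u \in U -> [/\ u \in G, commute z u & odd #[u]].
  move=> Uu; have /setIP[Gu /cent1P cu] := subsetP sUC u Uu.
  by split=> //; apply: dvdn_odd (order_dvdG Uu) oddU.
have coset : [set x in G | x.`_2 == z] = [set z * u | u in U].
  apply/setP=> x; rewrite inE; apply/andP/imsetP=> [[Gx /eqP xz] | [u Uu ->]].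
    exists x.`_2^'; last by rewrite -{1}(consttC 2 x) xz.
    rewrite (mem_normal_Hall hallU nU) ?p_elt_constt //.
    rewrite inE groupX //=; apply/cent1P; rewrite -xz.
    exact: commuteX2.
  have [Gu czu oddu] := Uspec u Uu; rewrite groupM // consttM //.
  rewrite (constt_p_elt (_ : 2.-elt z)); last by rewrite /p_elt oz.
  rewrite (constt1P _) ?mulg1 //.
  by rewrite /p_elt p'natE // dvdn2 negbK.
split; last by rewrite coset card_imset //; apply: mulgI.
rewrite (eq_bigl (mem [set x in G | x.`_2 == z])); last by move=> x; rewrite !inE.
rewrite coset big_imset /= => [|u v _ _]; last exact: mulgI.
rewrite /sum_orders big_distrr; apply: eq_bigr => u Uu.
by have [_ czu oddu] := Uspec u Uu; rewrite orderM // oz // coprime2n.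
Qed.

(** * The case of a normal 2-complement *)

Lemma inverted_abelian (gT : finGroupType) (K : {group gT}) s :
  {in K, forall u, u ^ s = u^-1} -> abelian K.
Proof.
move=> invK; apply/centsP=> u Ku v Kv; apply: invg_inj.
by rewrite -invK ?groupM // conjMg !invK // invMg.
Qed.

(** Modulo [K] the element [u * s] becomes [s], and [S] embeds in the quotient. *)
Lemma order_coset_rep (gT : finGroupType) (K S : {group gT}) u s :
    S \subset 'N(K) -> K :&: S = 1 -> u \in K -> s \in S ->
  #[s] %| #[u * s].
Proof.
move=> nKS tiKS Ku Ss; have nKs := subsetP nKS s Ss.
have nKu := subsetP (normG K) u Ku.
rewrite order_dvdn; apply/eqP/set1gP; rewrite -tiKS inE (groupX _ Ss) andbT.
apply: coset_idr; first by rewrite groupX.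
have eqs : coset K s = coset K (u * s) by rewrite morphM //= (coset_id Ku) mul1g.
by rewrite morphX //= eqs -morphX ?groupM //= expg_order morph1.
Qed.

Section OddNormal.

Variables (gT : finGroupType) (K : {group gT}) (s : gT).
Hypotheses (oddK : odd #|K|) (nKs : s \in 'N(K)) (os : #[s] = 2).

Let sV : s^-1 = s.
Proof. by apply/eqP; rewrite eq_invg_mul -[s * s]/(s ^+ 2) -os expg_order. Qed.

Let sqr_us u : (u * s) ^+ 2 = u * u ^ s.
Proof. by rewrite conjgE sV expgS expg1 !mulgA. Qed.

Let notKs u : u \in K -> u * s \notin K.
Proof.
move=> Ku; rewrite groupMl //; apply: contraL oddK => /order_dvdG.
by rewrite os dvdn2 => ->.
Qed.

Lemma invol_coset_order u : u \in K -> #[u * s] = 2 \/ (6 <= #[u * s])%N.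
Proof.
move=> Ku; have Kx2 : (u * s) ^+ 2 \in K by rewrite sqr_us groupM ?memJ_norm.
have oddx2 : odd #[(u * s) ^+ 2] by apply: dvdn_odd (order_dvdG Kx2) oddK.
have evenx : 2 %| #[u * s].
  (* An element of odd order is a power of its square, which here lies in [K]. *)
  rewrite dvdn2; apply: contra (notKs Ku) => oddx.
  have cox : coprime #|<[u * s]>| 2 by rewrite coprimen2.
  by rewrite -(expgK cox (cycle_id _)) groupX.
move: oddx2; rewrite orderXdiv //; move: evenx => /dvdnP[k ->].
by rewrite mulnK //; case: k => [|[|[|k]]] // _; [left | right; lia].
Qed.

Lemma invol_coset_order2 u : u \in K -> (#[u * s] == 2) = (u ^ s == u^-1).
Proof.
move=> Ku; rewrite [RHS]eq_sym eq_invg_mul -sqr_us.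
apply/eqP/eqP=> [<- | x2]; first exact: expg_order.
apply: nt_prime_order => //; apply: contraNneq (notKs Ku) => ->.
exact: group1.
Qed.

(* An inverted element u of odd order is v^2 with v inverted, and v^2 s = s^(v^-1). *)
Lemma invol_coset_sub_class u : u \in K -> u ^ s = u^-1 -> u * s \in s ^: K.
Proof.
move=> Ku us; have oddu : odd #[u] by apply: dvdn_odd (order_dvdG Ku) oddK.
pose v := u ^+ (#[u]./2.+1); have Kv : v \in K by rewrite groupX.
have v2 : v * v = u.
  rewrite -expgD (_ : _ + _ = #[u].+1)%N; last by lia.
  by rewrite expgS expg_order mulg1.
apply/imsetP; exists v^-1; first by rewrite groupV.
have vs : v ^ s = v^-1 by rewrite conjXg us expgVn.
by rewrite conjgE invgK -vs conjgE mulKVg mulgA v2.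
Qed.

(** If C_K(s) = 1, the class of [s] under [K] fills the coset Ks, so [s] inverts [K]. Otherwise
    |C_K(s)| >= 3, at most a third of the coset consists of involutions, and the rest have order at
    least 6: the average is at least 2/3 + 4 = 14/3. *)
Lemma sum_orders_invol_coset :
  {in K, forall u, u ^ s = u^-1} \/ (14 * #|K| <= 3 * \sum_(u in K) #[u * s])%N.
Proof.
pose A := [set u in K | u ^ s == u^-1].
have sAK : A \subset K by apply/subsetP=> u; rewrite inE => /andP[].
have leA : (#|A| <= #|s ^: K|)%N.
  rewrite -(card_imset _ (mulIg s)); apply: subset_leq_card.
  apply/subsetP=> _ /imsetP[u /[!inE] /andP[Ku /eqP us] ->].
  exact: invol_coset_sub_class.
case: (eqVneq ('C_K[s]) 1) => [cK1 | ntC]; [left | right].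
  have eqK : s ^: K = [set x * s | x in K].
    apply/eqP; rewrite eqEcard card_imset; last exact: mulIg.
    rewrite -index_cent1 cK1 indexg1 leqnn andbT.
    apply/subsetP=> _ /imsetP[v Kv ->]; apply/imsetP.
    exists (v^-1 * v ^ s^-1); first by rewrite groupM ?groupV ?memJ_norm ?groupV.
    by rewrite !conjgE !mulgA invgK mulgKV.
  move=> u Ku; apply/eqP; rewrite -invol_coset_order2 //.
  have: u * s \in s ^: K by rewrite eqK; apply/imsetP; exists u.
  by case/imsetP=> v _ ->; rewrite orderJ os.
have le3 : (3 * #|s ^: K| <= #|K|)%N.
  rewrite -index_cent1 -(Lagrange (subsetIl K 'C[s])) leq_mul2r; apply/orP; right.
  have := dvdn_odd (cardSg (subsetIl K 'C[s])) oddK.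
  by move: ntC; rewrite trivg_card1; case: #|_| => [|[|[]]].
have le6 : (2 * #|A| + 6 * (#|K| - #|A|) <= \sum_(u in K) #[u * s])%N.
  rewrite (big_setID A) /= (setIidPr sAK) -cardsDS //.
  rewrite leq_add // mulnC -sum_nat_const leq_sum // => u.
    by rewrite inE => /andP[Ku]; rewrite -(invol_coset_order2 Ku) => /eqP->.
  rewrite !inE => /andP[+ Ku]; rewrite Ku /= => nA.
  by have [/eqP|//] := invol_coset_order Ku; rewrite (invol_coset_order2 Ku) (negPf nA).
have := subset_leq_card sAK; lia.
Qed.

End OddNormal.

Lemma sum_orders_sdprod (gT : finGroupType) (G K S : {group gT}) :
  K ><| S = G -> sum_orders G = (\sum_(s in S) \sum_(u in K) #[u * s])%N.
Proof.
move=> defG; have [_ _ mulKS _ tiKS] := sdprod_context defG.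
rewrite exchange_big pair_big_dep /= /sum_orders -mulKS.
have imKS : [set p.1 * p.2 | p in setX K S] = K * S.
  by rewrite -[RHS]/(mulg @2: (K, S)) curry_imset2X; apply: eq_imset; case.
rewrite -imKS big_imset /=; first by apply: eq_bigl => p; rewrite inE.
by apply/imset_injP; rewrite imKS TI_cardMg // cardsX.
Qed.

(** Since |G| = 4|K|, the bound says o(G) > 211/60. The cosets of [K] are bounded one by one: an
    inverting involution gives only 2|K| but makes psi(K) at least (21/5)|K|, any other involution
    gives (14/3)|K|, and an element of order 4 gives 4|K|. *)
Lemma sum_orders_normal_2complement (gT : finGroupType) (G K S : {group gT}) :
    K ><| S = G -> #|S| = 4 -> odd #|K| -> (15 %| #|K|)%N ->
  (211 * #|K| < 15 * sum_orders G)%N.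
Proof.
move=> defG oS oddK dK; have [_ _ _ nKS tiKS] := sdprod_context defG.
have geK : (15 <= #|K|)%N by rewrite dvdn_leq.
have d5 : (5 %| #|K|)%N by apply: dvdn_trans dK.
have psiK := sum_orders_odd_group oddK.
have abK s : {in K, forall u, u ^ s = u^-1} -> (21 * #|K| <= 5 * sum_orders K)%N.
  by move=> invK; apply: sum_orders_abelian (inverted_abelian invK).
pose sigma s := (\sum_(u in K) #[u * s])%N.
have sigma1 : sigma 1 = sum_orders K by apply: eq_bigr => u _; rewrite mulg1.
have sigma_ge s : s \in S -> (#[s] * #|K| <= sigma s)%N.
  move=> Ss; rewrite mulnC -sum_nat_const leq_sum // => u Ku.
  by rewrite dvdn_leq // (order_coset_rep nKS tiKS).
have sum4 a b c : a \in S^# -> b \in S^# -> c \in S^# -> a != b -> a != c -> b != c ->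
    sum_orders G = (sum_orders K + sigma a + sigma b + sigma c)%N.
  move=> /setD1P[nta Sa] /setD1P[ntb Sb] /setD1P[ntc Sc] nab nac nbc.
  rewrite eq_sym in nta; rewrite eq_sym in ntb; rewrite eq_sym in ntc.
  rewrite (sum_orders_sdprod defG) -/(sigma _).
  have defS : S :=: [set 1; a; b; c].
    apply/esym/eqP; rewrite eqEcard oS; apply/andP; split.
      by apply/subsetP=> x; rewrite !inE => /orP[/orP[/orP[]|]|] /eqP->.
    by rewrite -!setUA !cardsU1 cards1 !inE !negb_or nta ntb ntc nab nac nbc.
  rewrite defS -!setUA !big_setU1 ?big_set1 ?inE ?negb_or ?nta ?ntb ?ntc //=;
    rewrite ?nab ?nac ?nbc //=.
  by rewrite !addnA -sigma1.
have invol s : s \in S -> #[s] = 2 ->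
    {in K, forall u, u ^ s = u^-1} \/ (14 * #|K| <= 3 * sigma s)%N.
  by move=> Ss os; apply: sum_orders_invol_coset; rewrite ?(subsetP nKS).
have nt_order2 s : s \in S -> s != 1 -> #[s] = 2 \/ #[s] = 4.
  move=> Ss; rewrite -order_eq1; have := order_dvdG Ss; rewrite oS.
  by case: #[s] => [|[|[|[|[|]]]]] //; auto.
have [/exists_inP[s Ss /eqP os] | /exists_inPn no4] :=
  boolP [exists s in S, #[s] == 4].
  have nts : s != 1 by rewrite -order_eq1 os.
  have os2 : #[s ^+ 2] = 2 by rewrite orderXdiv os.
  have nts2 : s ^+ 2 != 1 by rewrite -order_eq1 os2.
  have nsV : s != s^-1 by rewrite eq_sym eq_invg_mul.
  have s_s2 : s != s ^+ 2 by apply: contra_eq_neq os => ->; rewrite os2.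
  have sV_s2 : s^-1 != s ^+ 2 by apply: contra_eq_neq os;
    rewrite -orderV => ->; rewrite os2.
  rewrite (sum4 s s^-1 (s ^+ 2)) ?inE ?invg_eq1 ?nts ?nts2 ?groupV ?groupX //.
  have := sigma_ge s Ss; have := sigma_ge s^-1 (groupVr Ss); rewrite orderV os.
  have := sigma_ge _ (groupX 2 Ss); rewrite os2.
  have [/abK|] := invol _ (groupX 2 Ss) os2; move: psiK geK;
    move: (sigma s) (sigma s^-1) (sigma (s ^+ 2)) (sum_orders K) #|K|; clear; lia.
have order2 s : s \in S^# -> #[s] = 2.
  case/setD1P=> nts Ss; have [] // := nt_order2 s Ss nts.
  by move/eqP; rewrite (negPf (no4 s Ss)).
have card_S1 : #|S^#| = 3 by have := cardsD1 1 S; rewrite group1 oS => -[].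
have /card_gt0P[a Sa] : (0 < #|S^#|)%N by rewrite card_S1.
have /card_gt0P[b /setD1P[nba Sb]] : (0 < #|S^# :\ a|)%N.
  by have := cardsD1 a S^#; rewrite Sa card_S1; case: #|_|.
have [[nta Sa1] [ntb Sb1]] := (setD1P Sa, setD1P Sb).
have invo x : x \in S^# -> x * x = 1.
  by move=> Sx; rewrite -[x * x]/(x ^+ 2) -(order2 x Sx) expg_order.
have Sc : a * b \in S^#.
  by rewrite !inE groupM // andbT -(inj_eq (mulgI a)) mulgA invo // mul1g mulg1.
(* A product of two inverting elements centralises [K], so on its coset all orders double. *)
have cent x y : {in K, forall u, u ^ x = u^-1} -> {in K, forall u, u ^ y = u^-1} ->
    x * y \in S^# -> sigma (x * y) = (2 * sum_orders K)%N.
  move=> invx invy Sxy; rewrite /sum_orders big_distrr; apply: eq_bigr => u Ku.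
  have oddu : odd #[u] by apply: dvdn_odd (order_dvdG Ku) oddK.
  have cux : commute u (x * y).
    by apply/commgP/conjg_fixP; rewrite conjgM invx // invy ?groupV // invgK.
  by rewrite orderM // (order2 _ Sxy) ?coprimen2 // mulnC.
have cent_b := cent a (a * b); rewrite mulgA invo // mul1g in cent_b.
have cent_a := cent (a * b) b; rewrite -mulgA (invo b) // mulg1 in cent_a.
rewrite (sum4 a b (a * b)) //; last first.
- by rewrite -{1}[b]mul1g (inj_eq (mulIg b)) eq_sym.
- by rewrite -{1}[a]mulg1 (inj_eq (mulgI a)) eq_sym.
- by rewrite eq_sym.
have := sigma_ge a Sa1; have := sigma_ge b Sb1; rewrite !order2 //.
have /setD1P[_ Sc1] := Sc.
have := sigma_ge _ Sc1; rewrite order2 //.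
have [ia|na] := invol a Sa1 (order2 a Sa).
  have := abK _ ia.
  have [ib|nb] := invol b Sb1 (order2 b Sb).
    by rewrite (cent a b) //; move: geK;
      move: (sigma a) (sigma b) (sum_orders K) #|K|; clear; lia.
  have [ic|nc] := invol _ Sc1 (order2 _ Sc).
    by rewrite cent_b //; move: geK;
      move: (sigma a) (sigma b) (sum_orders K) #|K|; clear; lia.
  by move: nb nc geK;
    move: (sigma a) (sigma b) (sigma (a * b)) (sum_orders K) #|K|; clear; lia.
have [ib|nb] := invol b Sb1 (order2 b Sb).
  have := abK _ ib.
  have [ic|nc] := invol _ Sc1 (order2 _ Sc).
    by rewrite cent_a //; move: geK;
      move: (sigma a) (sigma b) (sum_orders K) #|K|; clear; lia.
  by move: na nc geK;
    move: (sigma a) (sigma b) (sigma (a * b)) (sum_orders K) #|K|; clear; lia.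
(* Here the total is at least (3 + 28/3 + 2)|K| - 2, and |K| >= 15 absorbs the 2. *)
by move: na nb geK psiK;
  move: (sigma a) (sigma b) (sigma (a * b)) (sum_orders K) #|K|; clear; lia.
Qed.

(** * The fused case: centralisers of involutions and solutions of x^3 = 1 *)

(* From x^3 = 1 one gets (t x)^3 = t * t^(x^-1) * t^(x^-2). *)
Lemma cube_invol_mul (gT : finGroupType) (t x : gT) :
    #[t] = 2 -> x ^+ 3 = 1 -> (t * x) ^+ 3 = 1 ->
  commute t (t ^ x^-1) /\ t ^ x^-1 != t.
Proof.
move=> ot x3 tx3; set w := t ^ x^-1.
have sqr y : #[y] = 2 -> y * y = 1 by rewrite -[y * y]/(y ^+ 2) => <-; apply: expg_order.
have twwV : t * w * (w ^ x^-1) = 1.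
  rewrite -[RHS]tx3 -[LHS]mulg1 -x3 /w !conjgE invgK !expgS expg0 !mulgA !mulg1.
  by rewrite !mulgKV.
(* So [t * w] is itself an involution; hence [t] and [w] commute and are distinct. *)
have tw : t * w = w ^ x^-1.
  apply/eqP; rewrite eq_mulgV1; apply/eqP; rewrite -[RHS]twwV; congr (_ * _).
  by apply/eqP; rewrite eq_invg_mul sqr // !orderJ.
have ow : #[w ^ x^-1] = 2 by rewrite !orderJ.
split.
  have tVw : (t * w)^-1 = t * w by apply/eqP; rewrite eq_invg_mul tw sqr.
  have tV : t^-1 = t by apply/eqP; rewrite eq_invg_mul sqr.
  have wV : w^-1 = w by apply/eqP; rewrite eq_invg_mul sqr // orderJ.
  by rewrite /commute -tVw invMg tV wV.
by apply: contra_eq_neq ow => wt; rewrite -tw wt sqr // order1.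
Qed.

Lemma leq_card_bigcup (I T : finType) (P : pred I) (F : I -> {set T}) :
  (#|\bigcup_(i | P i) F i| <= \sum_(i | P i) #|F i|)%N.
Proof.
elim/big_rec2: _ => [|i n A _ leAn]; first by rewrite cards0.
by apply: leq_trans (leq_card_setU _ _) _; rewrite leq_add2l.
Qed.

Section FusedFourGroup.

Variables (gT : finGroupType) (G S : {group gT}) (t : gT).
Hypotheses (sylS : 2.-Sylow(G) S) (oS : #|S| = 4) (St : t \in S^#).
Hypothesis fusS : {in S^#, forall s, s ^: 'N_G(S) = S^#}.

Let sSG : S \subset G := pHall_sub sylS.
Let cSS : abelian S.
Proof. exact: (@card_p2group_abelian _ 2). Qed.

Lemma fused_order2 s : s \in S^# -> #[s] = 2.
Proof.
move=> Ss; have [||x Sx ox] := @Cauchy _ 2 S; rewrite ?oS //.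
have: x \in S^# by rewrite !inE Sx -order_eq1 ox.
by rewrite -(fusS Ss) => /imsetP[y _ def_x]; rewrite -ox def_x orderJ.
Qed.

Local Notation invols := (t ^: G).

(** Sylow's theorem moves [x] into [S], where the normaliser is transitive on nontrivial
    elements. *)
Lemma fused_invols x : x \in G -> 2.-elt x -> x != 1 -> x \in invols.
Proof.
move=> Gx p2x ntx; have sxG : <[x]> \subset G by rewrite cycle_subG.
have [y Gy] := Sylow_Jsub sylS sxG p2x.
rewrite -cycleJ cycle_subG => Sxy.
have : x ^ y \in t ^: 'N_G(S) by rewrite fusS // !inE conjg_eq1 ntx.
case/imsetP=> z /setIP[Gz _] def_xy; apply/imsetP.
by exists (z * y^-1); rewrite ?groupM ?groupV // conjgM -def_xy conjgK.
Qed.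

Local Notation U z := 'O_2^'('C_G[z])%G.

Lemma sub_fused_invols : S^# \subset invols.
Proof. by rewrite -(fusS St) imsetS // subsetIl. Qed.

Lemma fused_cent z : z \in invols ->
  exists2 Q : {group gT}, 2.-Sylow(G) Q /\ z \in Q^# & U z ><| Q = 'C_G[z].
Proof.
case/imsetP=> y Gy ->; exists (S :^ y)%G.
  split; first by rewrite pHallJ.
  by move: St; rewrite !inE conjg_eq1 /= memJ_conjg.
apply: Sylow2_order4_cent1; rewrite ?pHallJ ?cardJg //.
by move: St; rewrite !inE conjg_eq1 /= memJ_conjg.
Qed.

Lemma fused_cent_Hall z : z \in invols ->
  [/\ 2^'.-Hall('C_G[z]) (U z), U z <| 'C_G[z], #|'C_G[z]| = (4 * #|U z|)%N
     & #|U z| = #|U t| ].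
Proof.
have cardC y : y \in invols -> #|'C_G[y]| = (4 * #|U y|)%N.
  case/fused_cent=> Q [sylQ _] /sdprod_card <-.
  by rewrite mulnC (card_Hall sylQ) -(card_Hall sylS) oS.
move=> Iz; have [Q [sylQ Qz] defC] := fused_cent Iz.
have It : t \in invols := class_refl G t.
split; first 1 last.
- exact: pcore_normal.
- exact: cardC.
- apply/eqP; rewrite -(@eqn_pmul2l 4) // -!cardC //.
  have : (#|invols| * #|'C_G[z]| = #|invols| * #|'C_G[t]|)%N.
    rewrite -[in LHS](class_eqP Iz) -!index_cent1 mulnC Lagrange ?subsetIl //.
    by rewrite mulnC Lagrange ?subsetIl.
  by move/eqP; rewrite eqn_pmul2l // (cardD1 t) class_refl.
apply/and3P; split; rewrite ?pcore_sub ?pcore_pgroup //.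
rewrite -divgS ?pcore_sub // cardC // mulnK ?cardG_gt0 //.
Qed.

Lemma card_fused : #|G| = (4 * (#|invols| * #|U t|))%N.
Proof.
have [_ _ cardC _] := fused_cent_Hall (class_refl G t).
by rewrite mulnCA -cardC -index_cent1 mulnC Lagrange ?subsetIl.
Qed.

Lemma fused_constt2 x : x \in G -> (x.`_2 \in invols) = (x.`_2 != 1).
Proof.
move=> Gx; apply/idP/idP=> [Ix|]; last first.
  by apply: fused_invols; rewrite ?groupX ?p_elt_constt.
have /setD1P[nt_t _] := St.
by case/imsetP: Ix => y _ ->; rewrite conjg_eq1.
Qed.

Lemma fused_big_split (F : gT -> nat) :
  (\sum_(x in G) F x = \sum_(x in G | x.`_2 == 1%g) F x +
     \sum_(z in invols) \sum_(x in G | x.`_2 == z) F x)%N.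
Proof.
rewrite (bigID (fun x => x.`_2 == 1%g)) /=; congr (_ + _)%N.
rewrite (partition_big (fun x => x.`_2) (mem invols)) /= => [|x /andP[Gx]]; last first.
  by rewrite fused_constt2.
apply: eq_bigr => z Iz; apply: eq_bigl => x; rewrite -andbA.
case Gx: (x \in G) => //=; case: (x.`_2 =P z) => [xz | _]; rewrite ?andbF //.
by rewrite -fused_constt2 // xz Iz.
Qed.

Let sum_invol z : z \in invols ->
  (\sum_(x in G | x.`_2 == z) #[x] = 2 * sum_orders (U z))%N
  /\ #|[set x in G | x.`_2 == z]| = #|U t|.
Proof.
move=> Iz; have [hallU nU _ <-] := fused_cent_Hall Iz.
apply: sum_orders_constt2 => //; case/imsetP: Iz => y Gy ->.
  by rewrite groupJ // (subsetP sSG) //; have /setD1P[] := St.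
by rewrite orderJ fused_order2.
Qed.

Lemma fused_sum_orders :
  sum_orders G = (\sum_(x in G | x.`_2 == 1%g) #[x] +
                  \sum_(z in invols) 2 * sum_orders (U z))%N.
Proof.
rewrite /sum_orders fused_big_split; congr (_ + _)%N.
by apply: eq_bigr => z /sum_invol[].
Qed.

Lemma fused_card_odd :
  #|[set x in G | x.`_2 == 1]| = (3 * (#|invols| * #|U t|))%N.
Proof.
have sumI : (\sum_(z in invols) \sum_(x in G | x.`_2 == z) 1 = #|invols| * #|U t|)%N.
  rewrite -sum_nat_const; apply: eq_bigr => z /sum_invol[_ <-].
  by rewrite -sum1_card; apply: eq_bigl => x; rewrite inE.
have -> : #|[set x in G | x.`_2 == 1]| = (\sum_(x in G | x.`_2 == 1%g) 1)%N.
  by rewrite -sum1_card; apply: eq_bigl => x; rewrite inE.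
have := card_fused; rewrite -sum1_card fused_big_split sumI.
by move: (bigop _ _ _) (_ * _)%N => a b; clear; lia.
Qed.

Let odd_U z : z \in invols -> odd #|U z|.
Proof.
case/fused_cent_Hall=> /pHall_pgroup + _ _ _.
by rewrite /pgroup p'natE // dvdn2 negbK.
Qed.

Let T := [set x in G | x ^+ 3 == 1].

Let O := [set x in G | x.`_2 == 1].

Let sum_O : (\sum_(x in G | x.`_2 == 1%g) #[x] = 1 + \sum_(x in O :\ 1%g) #[x])%N.
Proof.
rewrite (eq_bigl (fun x => x \in O)) => [|x]; last by rewrite /O inE.
by rewrite (big_setD1 1) ?order1 //= /O inE group1 constt1 eqxx.
Qed.

Let card_O1 : (#|O :\ 1%g| + 1 = 3 * (#|invols| * #|U t|))%N.
Proof.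
by rewrite -fused_card_odd (cardsD1 1 O) addnC /O inE group1 constt1 eqxx.
Qed.

Let O1_odd x : x \in O :\ 1 -> odd #[x] /\ x != 1.
Proof.
rewrite /O !inE => /andP[ntx /andP[_ /eqP/constt1P]].
by rewrite /p_elt p'natE // dvdn2 negbK.
Qed.

Lemma fused_odd_part_ge9 :
  (9 * (#|invols| * #|U t|) <= \sum_(x in G | x.`_2 == 1%g) #[x] + 2)%N.
Proof.
have: (#|O :\ 1%g| * 3 <= \sum_(x in O :\ 1%g) #[x])%N.
  rewrite -sum_nat_const leq_sum // => x /O1_odd[].
  by rewrite -order_eq1; case: #[x] => [|[|[]]].
by rewrite sum_O; move: card_O1;
  move: (#|invols| * #|U t|)%N #|O :\ 1%g| (bigop _ _ _); clear; lia.
Qed.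

(** Among nontrivial elements of odd order, only those of order 3 fall below 5; the term in [T]
    makes up their deficit of 2. *)
Lemma fused_odd_part_ge15 :
  (15 * (#|invols| * #|U t|) <= \sum_(x in G | x.`_2 == 1%g) #[x] + 2 * #|T| + 2)%N.
Proof.
have: (#|O :\ 1%g| * 5 <= \sum_(x in O :\ 1%g) #[x] + 2 * #|T :\ 1%g|)%N.
  have -> : (\sum_(x in O :\ 1%g) #[x] + 2 * #|T :\ 1%g| =
             \sum_(x in O :\ 1%g) (#[x] + 2 * (x \in T)))%N.
    rewrite big_split /= -big_distrr; congr (_ + 2 * _)%N.
    transitivity (\sum_(x in O :\ 1%g) if x \in T then 1 else 0)%N; last first.
      by apply: eq_bigr => x _; case: (x \in T).
    rewrite -sum1_card -big_mkcondr; apply: eq_bigl => x; rewrite /O /T !inE.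
    case: eqP => //= _; case Gx: (x \in G) => //=.
    case: (x ^+ 3 =P 1) => x3; rewrite ?andbF // andbT; apply/esym/eqP/constt1P.
    by apply: (@pnat_dvd _ 3); rewrite ?order_dvdn ?x3.
  rewrite -sum_nat_const leq_sum // => x O1x; have [] := O1_odd O1x.
  rewrite -order_eq1 /T inE -order_dvdn; have /setD1P[_] := O1x.
  by rewrite /O inE => /andP[-> _]; case: #[x] => [|[|[|[|[|[]]]]]].
have: (#|T :\ 1%g| + 1 = #|T|)%N.
  by rewrite (cardsD1 1 T) addnC /T inE group1 expg1n eqxx.
rewrite sum_O; move: card_O1;
move: (#|invols| * #|U t|)%N #|O :\ 1%g| #|T :\ 1%g| #|T| (bigop _ _ _); clear; lia.
Qed.

Let sum_orders_U z : z \in invols -> (3 * #|U t| <= sum_orders (U z) + 2)%N.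
Proof.
move=> Iz; have [_ _ _ <-] := fused_cent_Hall Iz.
exact: sum_orders_odd_group (odd_U Iz).
Qed.

Lemma fused_even_part_ge :
  (6 * (#|invols| * #|U t|) <= \sum_(z in invols) 2 * sum_orders (U z) + 4 * #|invols|)%N.
Proof.
rewrite mulnCA -sum_nat_const [(4 * _)%N]mulnC -sum_nat_const -big_split /=.
by apply: leq_sum => z /sum_orders_U; move: (sum_orders _) #|_|; clear; lia.
Qed.

(** Every nontrivial element of a group of order 5 has order 5, so psi is 21; this sharper bound
    excludes the value 5 in [fused_cases]. *)
Lemma fused_even_part_ge5 : #|U t| = 5 ->
  (42 * #|invols| <= \sum_(z in invols) 2 * sum_orders (U z))%N.
Proof.
move=> Ut5; rewrite mulnC -sum_nat_const; apply: leq_sum => z Iz.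
have [_ _ _ oU] := fused_cent_Hall Iz; rewrite Ut5 in oU.
rewrite -[42]/(2 * 21)%N leq_mul2l /= /sum_orders (big_setD1 1) //= order1.
have := cardsD1 1 (U z); rewrite oU group1 add1n => -[oU1].
rewrite -[21]/(1 + 4 * 5)%N leq_add2l {1}oU1 -sum_nat_const leq_sum // => x.
case/setD1P; rewrite -order_eq1 => + Ux; have := order_dvdG Ux; rewrite oU.
by case: #[x] => [|[|[|[|[]]]]].
Qed.

(** Put i = |t^G| and c = |U t|, so |G| = 4ic. The bounds 9ic - 2 and 6ic - 4i on the odd and even
    parts give 56ic <= 240i + 120, hence c < 7. For c = 1 and c = 3 the odd bound 15ic - 2|T| - 2
    yields the stated inequalities. *)
Lemma fused_cases : odd #|invols| -> (60 * sum_orders G <= 211 * #|G|)%N ->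
     [/\ #|U t| = 1%N & 44 * #|invols| <= 30 * #|T| + 30]%N
  \/ [/\ #|U t| = 3 & 84 * (3 * #|invols|) <= 30 * #|T| + 30]%N.
Proof.
rewrite fused_sum_orders card_fused => oddI.
have := fused_odd_part_ge9; have := fused_odd_part_ge15.
have := fused_even_part_ge; have := fused_even_part_ge5.
have := odd_U (class_refl G t); move: oddI.
move: (bigop _ _ _) (bigop _ _ _) #|T| #|t ^: G| #|U t|.
clear=> a b y i c oddI oddC even5 even odd15 odd9 le_psi.
have i_gt0 : (0 < i)%N by case: i oddI {even5 even odd15 odd9 le_psi}.
case: c oddC even5 even odd15 odd9 le_psi => [|[|[|[|[|[|[|c]]]]]]] //= oddC.
- by move=> _ even odd15 odd9 le_psi; left; split=> //; lia.
- by move=> _ even odd15 odd9 le_psi; right; split=> //; lia.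
- by move=> /(_ erefl) even5 even odd15 odd9 le_psi; lia.
move=> _ even _ odd9 le_psi; suff: (7 * i <= i * c.+3.+4)%N by lia.
by rewrite mulnC leq_mul2l orbT.
Qed.

Lemma fused_cent1_eq : #|U t| = 1%N -> {in S^#, forall s, 'C_G[s] = S}.
Proof.
move=> U1 s Ss; have Is : s \in invols by apply: (subsetP sub_fused_invols).
have [_ _ cardC oU] := fused_cent_Hall Is.
apply/esym/eqP; rewrite eqEcard cardC oU U1 oS leqnn andbT subsetI sSG.
by rewrite sub_cent1 (subsetP cSS) //; have /setD1P[] := Ss.
Qed.

(** By [cube_invol_mul], [s ^ x^-1] lies in C_G(s) = S; its centraliser is then both [S] and the
    conjugate of [S] by [x^-1]. *)
Lemma fused_cube_normaliser s x : #|U t| = 1%N -> s \in S^# ->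
  x \in T -> s * x \in T -> x \in 'N_G(S).
Proof.
rewrite /T => U1 Ss /setIdP[Gx /eqP x3] /setIdP[_ /eqP sx3].
have [csw nsw] := cube_invol_mul (fused_order2 Ss) x3 sx3.
have CS := fused_cent1_eq U1; have /setD1P[nts S_s] := Ss.
have Sw : s ^ x^-1 \in S^#.
  rewrite 2!inE conjg_eq1 nts -(CS s Ss) inE groupJ ?groupV ?(subsetP sSG s S_s) //=.
  exact/cent1P/commute_sym.
rewrite inE Gx -groupV /=; apply/normP.
by rewrite -[in LHS](CS s Ss) conjIg conjGid ?groupV // -cent1J CS.
Qed.

Lemma fused_normaliser_card : #|U t| = 1%N -> #|'N_G(S)| = 12.
Proof.
move=> U1; rewrite -(Lagrange (subsetIl 'N_G(S) 'C[t])) index_cent1 fusS //=.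
have -> : 'N_G(S) :&: 'C[t] = S.
  rewrite setIAC (fused_cent1_eq U1) //; apply/setIidPl; exact: normG.
by rewrite oS; have := cardsD1 1 S; rewrite oS group1 add1n => -[<-].
Qed.

(** The normaliser has 12 elements, three of them involutions of [S], so it contains at most 9
    elements of [T]. Outside it there are at most (|G| - 12)/4. *)
Lemma fused_card_cubes_U1 : #|U t| = 1%N -> (#|T| <= #|invols| + 6)%N.
Proof.
move=> U1; pose D := 'N_G(S).
have sTG : T \subset G by apply/subsetP=> x; rewrite inE => /andP[].
have sSD : S \subset D by rewrite subsetI sSG normG.
have oD : #|D| = 12 := fused_normaliser_card U1.
have leTD : (#|T :&: D| <= 9)%N.
  have: T :&: D \subset D :\: S^#.
    apply/subsetP=> x /setIP[Tx Dx]; rewrite inE Dx andbT.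
    apply/negP=> Sx; move: Tx; rewrite /T inE -order_dvdn (fused_order2 Sx).
    by rewrite andbF.
  move/subset_leq_card/leq_trans; apply.
  rewrite cardsDS ?oD; last by apply: subset_trans sSD; apply: subsetDl.
  by have := cardsD1 1 S; rewrite oS group1 add1n => -[<-].
(* A coset Sx outside D meets T at most once. *)
have leTnD : (4 * #|T :\: D| <= #|G| - 12)%N.
  rewrite -oD -cardsDS ?subsetIl // -oS -cardsX.
  rewrite -(@card_in_imset _ _ (fun p => p.1 * p.2)) => [|[s x] [s' x']]; last first.
    case/setXP=> /= Ss /setDP[Tx nDx] /setXP[/= Ss' /setDP[Tx' _]] eqsx.
    have [|ns] := eqVneq s s'; first by move=> e; move: eqsx; rewrite e => /mulgI->.
    have eqx' : s'^-1 * s * x = x' by rewrite -mulgA eqsx mulKg.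
    case/negP: nDx; apply: (@fused_cube_normaliser (s'^-1 * s)); rewrite ?eqx' //.
    by rewrite !inE -eq_mulVg1 eq_sym ns groupM ?groupV.
  apply: subset_leq_card; apply/subsetP=> _ /imsetP[[s x] + ->].
  case/setXP=> /= Ss /setDP[Tx nDx].
  apply/setDP; split; first by rewrite groupM ?(subsetP sTG x Tx) ?(subsetP sSG s Ss).
  by rewrite groupMl ?(subsetP sSD s Ss).
have := subset_leq_card (subsetIl G 'N(S)); rewrite oD.
have := card_fused; rewrite U1 muln1.
have := cardsID D T; move: leTD leTnD.
by move: #|T :&: D| #|T :\: D| #|T| #|G| #|invols|; clear; lia.
Qed.

(** [T] and tT have equal size; their union misses the 6 elements of [W]. On their intersection x ->
    t^(x^-1) takes values in [W], with fibres inside left cosets of C_G(t), so it has at most 6 * 12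
    = 72 elements. *)
Lemma fused_card_cubes_U3 : #|U t| = 3 -> (2 * #|T| <= #|G| + 66)%N.
Proof.
move=> U3; have It : t \in invols := class_refl G t.
have [hallU nU cardC _] := fused_cent_Hall It; rewrite U3 in cardC.
have sUC : U t \subset 'C_G[t] := pHall_sub hallU.
have [ot Gt] : #[t] = 2 /\ t \in G.
  by split; [exact: fused_order2 | have /setD1P[_] := St; apply: (subsetP sSG)].
have tV : t^-1 = t by apply/eqP; rewrite eq_invg_mul -[t * t]/(t ^+ 2) -ot expg_order.
have Ct : t \in 'C_G[t] by rewrite inE Gt cent1id.
have oddU x : x \in U t -> odd #[x].
  by move=> Ux; apply: dvdn_odd (order_dvdG Ux) (odd_U It).
have TU x : x \in T -> x \in 'C_G[t] -> x \in U t.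
  rewrite /T => /setIdP[_ x3] Cx; rewrite (mem_normal_Hall hallU nU Cx) /p_elt.
  by apply: (@pnat_dvd _ 3); rewrite ?order_dvdn.
(* W is disjoint from T and tT, and contains t^(x^-1) for x in both. *)
pose W := 'C_G[t] :\: (U t :|: t *: U t).
have oW : #|W| = 6.
  rewrite cardsDS ?cardC; last first.
    rewrite subUset sUC; apply/subsetP=> x /lcosetP[u Uu ->].
    by rewrite groupM // (subsetP sUC).
  suff -> : #|U t :|: t *: U t| = 6 by [].
  rewrite cardsU card_lcoset U3 [U t :&: _](_ : _ = set0) ?cards0 //.
  apply/eqP/set0Pn=> -[x /setIP[Ux]]; rewrite mem_lcoset groupMr // groupV.
  by move/oddU; rewrite ot.
have leTU : (#|T :|: t *: T| <= #|G| - 6)%N.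
  rewrite -oW -cardsDS; last by apply: subset_trans (subsetDl _ _) (subsetIl _ _).
  apply: subset_leq_card; apply/subsetP=> x; rewrite inE => TtTx.
  have Gx : x \in G.
    case/orP: TtTx; first by case/setIdP.
    by case/lcosetP=> y /setIdP[Gy _] ->; rewrite groupM.
  apply/setDP; split=> //; apply/negP=> /setDP[Cx] /negP[]; rewrite inE mem_lcoset.
  case/orP: TtTx => [Tx | /lcosetP[y Ty def_x]]; first by rewrite TU.
  have Cy : y \in 'C_G[t] by move: Cx; rewrite def_x groupMl.
  by rewrite def_x mulKg (TU y) ?orbT.
have leTI : (#|T :&: t *: T| <= 72)%N.
  rewrite -sum1_card (partition_big (fun x => t ^ x^-1) (mem W)) /= => [|x]; last first.
    rewrite inE mem_lcoset tV => /andP[/setIdP[Gx /eqP x3] /setIdP[_ /eqP tx3]].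
    have [ctw ntw] := cube_invol_mul ot x3 tx3.
    have Cw : t ^ x^-1 \in 'C_G[t].
      by rewrite inE groupJ ?groupV //; apply/cent1P/commute_sym.
    apply/setDP; split=> //; rewrite inE mem_lcoset; apply/norP; split.
      by apply/negP=> /oddU; rewrite orderJ ot.
    apply: contra ntw => /oddU; rewrite tV => odd_tw.
    have: #[t * t ^ x^-1] %| 2.
      rewrite order_dvdn expgMn // -conjXg -ot expg_order conj1g mulg1.
      exact: eqxx.
    have [o1|n1] := eqVneq #[t * t ^ x^-1] 1%N.
      by move/eqP: o1; rewrite order_eq1 -eq_invg_mul tV eq_sym.
    by move/(prime_nt_dvdP (isT : prime 2) n1) => o2; rewrite o2 in odd_tw.
  have -> : 72 = (#|W| * 12)%N by rewrite oW.
  rewrite -sum_nat_const; apply: leq_sum => w _.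
  rewrite sum1dep_card -[12]/(4 * 3)%N -cardC; set A := [set x | _].
  have [->|[x0]] := set_0Vmem A; first by rewrite cards0.
  rewrite [x0 \in A]inE => /andP[/setIP[/setIdP[Gx0 _] _] /eqP wx0].
  have sAC : A \subset x0 *: 'C_G[t].
    apply/subsetP=> x; rewrite inE => /andP[/setIP[/setIdP[Gx _] _] /eqP wx].
    rewrite mem_lcoset inE groupM ?groupV //; apply/cent1P/commute_sym/commgP/conjg_fixP.
    by rewrite conjgM wx0 -wx conjgKV.
  by rewrite -(card_lcoset 'C_G[t] x0) subset_leq_card.
have := cardsUI T (t *: T); rewrite card_lcoset.
have : (6 <= #|G|)%N.
  by rewrite -oW subset_leq_card // (subset_trans (subsetDl _ _)) ?subsetIl.
by move: leTU leTI; move: #|T :|: _| #|T :&: _| #|T| #|G|; clear; lia.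
Qed.

(** An element of order 3 permuting 5 involutions fixes one, [z] say, so it is one of the two
    nontrivial elements of [U z]; this leaves at most 1 + 5 * 2. *)
Lemma fused_card_cubes_U3_5 : #|U t| = 3 -> #|invols| = 5 -> (#|T| <= 11)%N.
Proof.
move=> U3 I5; suff: T \subset 1%g |: \bigcup_(z in invols) (U z :\ 1%g).
  move/subset_leq_card/leq_trans; apply; apply: leq_trans (leq_card_setU _ _) _.
  rewrite cards1 -[11]/(1 + 5 * 2)%N leq_add2l -I5 -sum_nat_const.
  apply: leq_trans (leq_card_bigcup _ _) _; apply: leq_sum => z Iz.
  have [_ _ _ oU] := fused_cent_Hall Iz.
  by have := cardsD1 1 (U z); rewrite oU U3 group1 add1n => -[<-].
apply/subsetP=> x; rewrite /T => /setIdP[Gx /eqP x3]; rewrite inE in_set1.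
have [//|ntx /=] := eqVneq x 1; have ox := nt_prime_order (isT : prime 3) x3 ntx.
have actx : [acts <[x]>, on invols | 'J].
  by rewrite /= astabsJ cycle_subG (subsetP (class_norm _ _)).
have px : 3.-group <[x]> by rewrite /pgroup -orderE ox.
have := pgroup_fix_mod px actx; rewrite I5 afixJ.
have [->|[z /setIP[Iz cxz]] _] := set_0Vmem 'C_invols(<[x]>); first by rewrite cards0.
have [hallU nU _ _] := fused_cent_Hall Iz.
apply/bigcupP; exists z => //; rewrite !inE ntx /= (mem_normal_Hall hallU nU).
  by rewrite /p_elt ox.
by rewrite inE Gx; move: cxz; rewrite cent_cycle => /cent1P/commute_sym/cent1P.
Qed.

End FusedFourGroup.

(** * Determination of the order of G *)

Lemma structure_of_average_order (gT : finGroupType) (G : {group gT}) :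
    (60 * sum_orders G = 211 * #|G|)%N ->
  exists S : {group gT},
    [/\ 2.-Sylow(G) S, #|G| = 60, #|'N_G(S)| = 12
      & {in S^#, forall s, 'C_G[s] = S} ].
Proof.
move=> psiG.
have /dvdnP[k oG] : (60 %| #|G|)%N.
  rewrite -(@Gauss_dvdr 60 211) // -psiG dvdn_mulr //.
have psi211 : sum_orders G = (211 * k)%N by lia.
have oddk : odd k by have := odd_sum_orders G; rewrite psi211 oddM.
have {}oG : #|G| = (4 * (15 * k))%N by lia.
have [S sylS] := Sylow_exists 2 G.
have oS : #|S| = 4.
  rewrite (card_Hall sylS) oG partnM // ?muln_gt0 ?(odd_gt0 oddk) //.
  rewrite [X in (_ * X)%N]part_p'nat; first by rewrite muln1 part_pnat_id.
  by rewrite p'natE // dvdn2 oddM oddk.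
have [cNS | fusS] := Sylow2_order4_fusion sylS oS.
  have defG := Burnside_normal_complement sylS cNS.
  have oK : #|'O_2^'(G)| = (15 * k)%N.
    by apply/eqP; rewrite -(@eqn_pmul2l 4) // -oG -(sdprod_card defG) oS mulnC.
  have := sum_orders_normal_2complement defG oS.
  by rewrite oK oddM oddk dvdn_mulr // psi211 => /(_ isT isT); lia.
have /card_gt0P[t St] : (0 < #|S^#|)%N.
  by have := cardsD1 1 S; rewrite oS group1; case: #|_|.
have := card_fused sylS oS St; rewrite oG => /eqP; rewrite eqn_pmul2l // => /eqP eq_ic.
have oddi : odd #|t ^: G| by have := congr1 odd eq_ic; rewrite !oddM oddk => /esym/andP[].
have := fused_cases sylS oS St fusS oddi; rewrite psi211 oG.
case; first by lia.
  case=> U1 le44; have leT := fused_card_cubes_U1 sylS oS St fusS U1.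
  (* With i = 15k the bounds give 660k <= 450k + 210. *)
  have k1 : k = 1%N by move: leT le44 eq_ic; rewrite U1; move: #|_| #|_| oddk; clear; lia.
  exists S; split=> //; first by rewrite k1.
    exact: fused_normaliser_card sylS oS St fusS U1.
  exact: (fused_cent1_eq sylS oS St fusS U1).
case=> U3 le84; have leT := fused_card_cubes_U3 sylS oS St fusS U3.
(* With i = 5k the bounds give 360k <= 1020, so k <= 2, and k is odd. *)
have k1 : k = 1%N.
  move: leT le84 eq_ic oddk; rewrite U3 oG; move: #|_| #|_|; clear; lia.
have i5 : #|t ^: G| = 5 by rewrite U3 k1 in eq_ic; lia.
have := fused_card_cubes_U3_5 sylS oS St U3 i5.
by move: le84; rewrite i5; move: #|_|; clear; lia.
Qed.

(** * Recognition of the alternating group on five letters *)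

Lemma card_Alt5 : #|'Alt_('I_5)| = 60.
Proof. by apply/eqP; rewrite -(eqn_pmul2l (isT : 0 < 2)%N) card_Alt ?card_ord. Qed.

(** Having index 2, [H] is normal, so it meets the simple group A_5 in 1 or in all of A_5; the first
    would need 3600 elements in the symmetric group. *)
Lemma Sym5_subgroup60 (H : {group {perm 'I_5}}) : #|H| = 60 -> H :=: 'Alt_('I_5).
Proof.
move=> oH; have oA := card_Alt5.
have nHG : H <| 'Sym_('I_5).
  apply: index2_normal; first exact: subsetT.
  by rewrite -divgS ?subsetT // card_Sym card_ord oH.
have /simpleP[_ simA] := simple_Alt5 (eq_leq (esym (card_ord 5))).
have nHA : H :&: 'Alt_('I_5) <| 'Alt_('I_5).
  by rewrite setIC; apply: normalGI nHG; apply: subsetT.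
have leHA : (#|H| * #|'Alt_('I_5)| <= 120 * #|H :&: 'Alt_('I_5)|)%N.
  rewrite mul_cardG leq_mul2r; apply/orP; right.
  by apply: leq_trans (subset_leq_card (subsetT _)) _;
    rewrite [X in (X <= _)%N]card_Sym card_ord.
case: (simA _ nHA) => [/= tiHA|/setIidPr sAH].
  by move: leHA; rewrite tiHA cards1 oH oA.
by apply/esym/eqP; rewrite eqEcard sAH oH oA.
Qed.

(** G acts on its five Sylow 2-subgroups. The kernel lies in N_G(S), of order 12, so it contains no
    class of an element of [S^#], which has size 15. Hence it meets [S] trivially, centralises [S],
    lies in C_G(s) = S, and is trivial. *)
Lemma order60_isog_Alt5 (gT : finGroupType) (G S : {group gT}) :
    2.-Sylow(G) S -> #|G| = 60 -> #|'N_G(S)| = 12 ->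
    {in S^#, forall s, 'C_G[s] = S} ->
  G \isog 'Alt_('I_5).
Proof.
move=> sylS oG oN CS; have sSG := pHall_sub sylS.
have oX : #|'Syl_2(G)| = 5 by rewrite (card_Syl sylS) -divgS ?subsetIl // oG oN.
have XS : S \in 'Syl_2(G) by rewrite inE.
pose h (i : 'I_5) : {group gT} := enum_val (cast_ord (esym oX) i).
pose k (Q : {group gT}) : 'I_5 := cast_ord oX (enum_rank_in XS Q).
have hX i : h i \in 'Syl_2(G) by apply: enum_valP.
have hK : cancel h k by move=> i; rewrite /k /h enum_valK_in cast_ordKV.
have kK : {in 'Syl_2(G), cancel k h}.
  by move=> Q XQ; rewrite /k /h cast_ordK enum_rankK_in.
have XJ Q g : g \in G -> Q \in 'Syl_2(G) -> (Q :^ g)%G \in 'Syl_2(G).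
  by move=> Gg; rewrite !inE pHallJ.
(* An action must be injective in the point for every [g] of the type, hence the identity outside
   [G]. *)
pose f i g := if g \in G then k (h i :^ g)%G else i.
have f_act : is_action G f.
  split=> [g i j | i g g' Gg Gg'].
    rewrite /f; case: ifP => // Gg /(congr1 h); rewrite !kK ?XJ //.
    by move/(congr1 val)/conjsg_inj/val_inj/(can_inj hK).
  rewrite /f groupM // Gg Gg' kK ?XJ //; congr k.
  by apply: val_inj; rewrite /= conjsgM.
pose phi := actperm (Action f_act).
have kerN g : g \in 'ker phi -> g \in 'N_G(S).
  rewrite ker_actperm => /setIP[Gg fixg]; rewrite inE Gg /=.
  have /(congr1 h): f (k S) g = k S.
    apply/eqP; move: fixg; rewrite inE => /subsetP/(_ (k S) (in_setT _)).
    by rewrite inE.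
  by rewrite /f Gg !kK ?XJ // => /(congr1 val)/normP.
pose K := 'ker phi; have nKG : K <| G := ker_normal _.
have sKN : K \subset 'N_G(S) by apply/subsetP=> g /kerN.
have [s Ss] : exists s, s \in S^#.
  apply/set0Pn; rewrite setD_eq0 subG1; apply: contra_eqN oN => /eqP->.
  by rewrite (setIidPl _) ?norm1 ?subsetT // oG.
have oS : #|S| = 4 by rewrite (card_Hall sylS) oG p_part.
have K1 : K :&: S = 1.
  apply/trivgP/subsetP=> x /setIP[Kx Sx]; apply/set1P/eqP.
  apply: contraT => ntx; have S1x : x \in S^# by apply/setD1P.
  have: x ^: G \subset 'N_G(S).
    by apply: subset_trans sKN; rewrite class_sub_norm ?normal_norm.
  by move/subset_leq_card; rewrite oN -index_cent1 CS // -divgS // oG oS.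
have inj_phi : 'injm phi.
  have cKS : K \subset 'C(S).
    apply/commG1P/trivgP; rewrite -K1 subsetI commg_subl commg_subr.
    by rewrite (subset_trans sSG (normal_norm nKG)) (subset_trans sKN (subsetIr _ _)).
  rewrite /= -K1 subsetI subxx -(CS s Ss) subsetI (subset_trans sKN) ?subsetIl //=.
  by apply: subset_trans cKS _; rewrite -cent_set1 centS // sub1set; have /setD1P[] := Ss.
have defIm : phi @* G = 'Alt_('I_5).
  by apply: Sym5_subgroup60; rewrite card_injm.
by rewrite -defIm sub_isog.
Qed.

(** * Isomorphism invariance and the value 211 for A_5 *)

Lemma sum_orders_isog (gT rT : finGroupType) (G : {group gT}) (H : {group rT}) :
  G \isog H -> sum_orders G = sum_orders H.
Proof.
case/isogP=> f injf defH; rewrite /sum_orders -defH morphimEdom.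
rewrite big_imset /=; last exact/injmP.
by apply: eq_bigr => x Gx; rewrite order_injm.
Qed.

(** Lists of images make the sum over A_5 accessible to [vm_compute]. *)
Definition perm_word n (s : {perm 'I_n}) : seq nat := [seq val (s i) | i <- enum 'I_n].

Definition word_mul (v w : seq nat) := [seq nth 0 w x | x <- v].

Lemma nth_perm_word n (s : {perm 'I_n}) (i : 'I_n) : nth 0 (perm_word s) i = s i.
Proof. by rewrite (nth_map i) ?size_enum_ord // nth_ord_enum. Qed.

Lemma perm_word_inj n : injective (@perm_word n).
Proof.
move=> s t eq_st; apply/permP=> i; apply: val_inj.
by rewrite /= -!nth_perm_word eq_st.
Qed.

Lemma perm_wordM n (s t : {perm 'I_n}) :
  perm_word (s * t) = word_mul (perm_word s) (perm_word t).
Proof.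
rewrite /word_mul -map_comp; apply: eq_map => i.
by rewrite /= nth_perm_word permM.
Qed.

Lemma perm_word1 n : perm_word (1 : {perm 'I_n}) = iota 0 n.
Proof. by rewrite -val_enum_ord; apply: eq_map => i; rewrite perm1. Qed.

(** The words are distinct permutations of [iota 0 n], and both lists have n! entries. *)
Lemma perm_word_enum n :
  perm_eq [seq perm_word s | s : {perm 'I_n}] (permutations (iota 0 n)).
Proof.
have Uw : uniq [seq perm_word s | s : {perm 'I_n}].
  by rewrite map_inj_uniq ?enum_uniq //; apply: perm_word_inj.
have subP : {subset [seq perm_word s | s : {perm 'I_n}] <= permutations (iota 0 n)}.
  move=> _ /mapP[s _ ->]; rewrite mem_permutations -val_enum_ord.
  rewrite /perm_word (map_comp val s); apply: perm_map.
  apply: uniq_perm; rewrite ?(map_inj_uniq perm_inj) ?enum_uniq // => i.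
  rewrite mem_enum; apply/mapP; exists (s^-1 i); rewrite ?mem_enum //.
  by rewrite permKV.
apply: uniq_perm; rewrite ?permutations_uniq //; apply: (uniq_min_size Uw subP _).2.
rewrite size_permutations ?iota_uniq // size_iota size_map -cardE.
by rewrite -cardsT card_Sym card_ord.
Qed.

(** The final 5 is a default, right for even permutations of five points, whose orders are 1, 2, 3
    and 5. *)
Definition word_order (w : seq nat) : nat :=
  let w2 := word_mul w w in
  if w == iota 0 5 then 1%N else if w2 == iota 0 5 then 2 else
  if word_mul w2 w == iota 0 5 then 3 else 5.

Definition square_words : seq (seq nat) :=
  undup [seq word_mul w w | w <- permutations (iota 0 5)].

(* Even permutations of five points are exactly the squares, which the permutation
   words can enumerate by computation. *)
Lemma sum_orders_Alt5 : sum_orders 'Alt_('I_5) = 211.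
Proof.
pose Q := [set s ^+ 2 | s : {perm 'I_5}].
have eqQ : perm_eq [seq perm_word s | s in Q] square_words.
  apply: uniq_perm; rewrite ?undup_uniq //.
    by rewrite map_inj_uniq ?enum_uniq //; apply: perm_word_inj.
  move=> w; rewrite mem_undup; apply/mapP/mapP=> [[s] | [v]].
    rewrite mem_enum => /imsetP[r _ ->] ->.
    exists (perm_word r); last by rewrite -perm_wordM.
    by rewrite -(perm_mem (perm_word_enum 5)) map_f ?mem_enum.
  rewrite -(perm_mem (perm_word_enum 5)) => /mapP[r _ ->] ->.
  by exists (r ^+ 2); rewrite ?perm_wordM // mem_enum; apply/imsetP; exists r.
(* This checks that the default 5 in [word_order] is only reached by words whose fifth power is
   trivial. *)
have words5 : all (fun w => let w2 := word_mul w w in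
    (word_order w == 5) ==> (word_mul (word_mul w2 w2) w == iota 0 5)) square_words.
  by vm_compute.
have orderQ s : s \in Q -> #[s] = word_order (perm_word s).
  move=> Qs; have: perm_word s \in square_words.
    by rewrite -(perm_mem eqQ) map_f ?mem_enum.
  move/(allP words5); rewrite /word_order -(perm_word1 5).
  lazy beta zeta; rewrite -!perm_wordM.
  rewrite !(inj_eq (@perm_word_inj _)).
  case: (s =P 1) => [-> _|/eqP nt_s]; first by rewrite order1.
  case: (s * s =P 1) => [s2 _|_]; first exact: (@nt_prime_order _ 2).
  case: (s * s * s =P 1) => [s3 _|_ /= /eqP s5].
    by apply: (@nt_prime_order _ 3); rewrite // !expgS expg0 mulg1 mulgA.
  by apply: (@nt_prime_order _ 5); rewrite // -s5 !expgS expg0 mulg1 !mulgA.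
(* Squares are even, and the computed number of squares is 60. *)
have defA : 'Alt_('I_5) = Q.
  apply/esym/eqP; rewrite eqEcard; apply/andP; split.
    by apply/subsetP=> _ /imsetP[s _ ->]; rewrite Alt_even odd_permM addbb.
  rewrite card_Alt5 cardE -(size_map (@perm_word 5)).
  by rewrite (perm_size eqQ); vm_compute.
rewrite /sum_orders /= defA (eq_bigr _ orderQ) -big_enum -(big_map (@perm_word 5) xpredT).
by rewrite (perm_big _ eqQ) /= -(big_map word_order xpredT id) -sumnE; vm_compute.
Qed.

Theorem corollary1p2 (gT : finGroupType) (G : {group gT}) :
  average_order G = (211%:R / 60%:R)%R <-> (G \isog 'Alt_('I_5))%g.
Proof.
have avgP : (average_order G = (211%:R / 60%:R)%R) <->
            (60 * sum_orders G = 211 * #|G|)%N.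
  rewrite /average_order; split=> [/eqP | psiG]; last apply/eqP.
    rewrite GRing.eqr_div ?Num.Theory.pnatr_eq0 -?lt0n ?cardG_gt0 //.
    by rewrite -!GRing.natrM Num.Theory.eqr_nat mulnC => /eqP.
  rewrite GRing.eqr_div ?Num.Theory.pnatr_eq0 -?lt0n ?cardG_gt0 //.
  by rewrite -!GRing.natrM Num.Theory.eqr_nat mulnC psiG.
split=> [/avgP/structure_of_average_order[S [sylS oG oN CS]] | isoG].
  exact: order60_isog_Alt5 sylS oG oN CS.
by apply/avgP; rewrite (sum_orders_isog isoG) sum_orders_Alt5 (card_isog isoG) card_Alt5.
Qed.
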